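(* Let $\Bbbk$ be a field and let $A$ be a $\Bbbk$-algebra. Suppose that $A$ is strongly Hopfian and that the center of $A$ is artinian. Then $A$ is Morita cancellative.
   Context: $\Bbbk$ is a base field and everything is over $\Bbbk$: all algebras are unital associative $\Bbbk$-algebras. $A[t]$ (or $A[t_1,\dots,t_n]$) denotes the polynomial algebra obtained from $A$ by adjoining central indeterminates. $M(A)$ denotes the category of right $A$-modules. Morita cancellative: $A$ is Morita cancellative if, for every algebra $B$, an equivalence of categories between $M(A[t])$ and $M(B[t])$ implies that $M(A)$ is equivalent to $M(B)$. Hopfian: $A$ is Hopfian if every $\Bbbk$-algebra epimorphism (surjective homomorphism) from $A$ to itself is an automorphism. $A$ is strongly Hopfian if $A[t_1,\dots,t_n]$ is Hopfian for every $n\ge 0$. *)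

(* Defs.v *)
From HB Require Import structures.
From mathcomp Require Import all_boot all_algebra.
From mathcomp Require Import boolp classical_sets.

Set Implicit Arguments.
Unset Strict Implicit.
Unset Printing Implicit Defensive.

Import GRing.Theory.

Local Open Scope ring_scope.
Local Open Scope classical_set_scope.

Record category := Category {
  obj : Type;
  hom : obj -> obj -> Type;
  idm : forall X, hom X X;
  compm : forall X Y Z, hom Y Z -> hom X Y -> hom X Z;
  comp1m : forall X Y (f : hom X Y), compm (idm Y) f = f;
  compm1 : forall X Y (f : hom X Y), compm f (idm X) = f;
  compmA : forall X Y Z T (f : hom Z T) (g : hom Y Z) (h : hom X Y),
    compm f (compm g h) = compm (compm f g) h }.

Record functor (C D : category) := Functor {
  fobj : obj C -> obj D;
  fmap : forall X Y : obj C, hom X Y -> hom (fobj X) (fobj Y);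
  fmap1 : forall X : obj C, fmap (idm X) = idm (fobj X);
  fmapM : forall (X Y Z : obj C) (f : hom Y Z) (g : hom X Y),
    fmap (compm f g) = compm (fmap f) (fmap g) }.

Definition functor_id (C : category) : functor C C :=
  @Functor C C (fun X => X) (fun _ _ f => f) (fun _ => erefl)
    (fun _ _ _ _ _ => erefl).

Section FunctorComp.

Variables (C D E : category) (G : functor D E) (F : functor C D).

Let cobj (X : obj C) : obj E := fobj G (fobj F X).
Let cmap (X Y : obj C) (f : hom X Y) : hom (cobj X) (cobj Y) :=
  fmap G (fmap F f).

Fact functor_comp_fmap1 (X : obj C) : cmap (idm X) = idm (cobj X).
Proof. by rewrite /cmap !fmap1. Qed.

Fact functor_comp_fmapM (X Y Z : obj C) (f : hom Y Z) (g : hom X Y) :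
  cmap (compm f g) = compm (cmap f) (cmap g).
Proof. by rewrite /cmap !fmapM. Qed.

Definition functor_comp : functor C E :=
  Functor functor_comp_fmap1 functor_comp_fmapM.

End FunctorComp.

Definition is_iso (C : category) (X Y : obj C) (f : hom X Y) : Prop :=
  exists g : hom Y X, compm g f = idm X /\ compm f g = idm Y.

Definition naturally_isomorphic (C D : category) (F G : functor C D) : Prop :=
  exists eta : forall X : obj C, hom (fobj F X) (fobj G X),
    (forall (X Y : obj C) (f : hom X Y),
       compm (eta Y) (fmap F f) = compm (fmap G f) (eta X)) /\
    (forall X : obj C, is_iso (eta X)).

Definition equivalent (C D : category) : Prop :=
  exists (F : functor C D) (G : functor D C),
    naturally_isomorphic (functor_comp G F) (functor_id C) /\
    naturally_isomorphic (functor_comp F G) (functor_id D).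

Lemma linear_funP (R : pzRingType) (M N : lmodType R) (f g : {linear M -> N}) :
  f =1 g -> f = g.
Proof.
case: f g => [f [[f1] [f2]]] [g [[g1] [g2]]] /= /funext fg.
by case: _ / fg in g1 g2 *; rewrite (Prop_irrelevance g1 f1)
  (Prop_irrelevance g2 f2).
Qed.

(* A right R-module is a left module over the converse ring R^c: for x : M,
   the right action x . a is (a : R^c) *: x. *)
Definition right_modules (R : nzRingType) : category :=
  @Category (lmodType R^c)
    (fun M N => {linear M -> N})
    (fun M => idfun : {linear M -> M})
    (fun M N P f g => f \o g : {linear M -> P})
    (fun M N f => @linear_funP _ M N (idfun \o f) f (fun _ => erefl))
    (fun M N f => @linear_funP _ M N (f \o idfun) f (fun _ => erefl))
    (fun M N P Q f g h =>
       @linear_funP _ M Q (f \o (g \o h)) ((f \o g) \o h) (fun _ => erefl)).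

(* {poly A} is canonically a module over A, not over k; the alias carries the
   k-algebra structure. The product of {poly A} makes 'X central, also when A
   is not commutative. *)
Definition polyalg (k : fieldType) (A : algType k) : Type := {poly A}.

Section PolyAlg.

Variables (k : fieldType) (A : algType k).

HB.instance Definition _ := GRing.NzRing.on (polyalg A).

Definition polyalg_scale (c : k) (p : polyalg A) : polyalg A :=
  (c%:A : A) *: (p : {poly A}).

Fact polyalg_scalerA c d p :
  polyalg_scale c (polyalg_scale d p) = polyalg_scale (c * d) p.
Proof. by rewrite /polyalg_scale scalerA -scalerAl mul1r scalerA. Qed.

Fact polyalg_scale1r : left_id 1 polyalg_scale.
Proof. by move=> p; rewrite /polyalg_scale !scale1r. Qed.

Fact polyalg_scalerDr : right_distributive polyalg_scale +%R.
Proof. by move=> c p q; rewrite /polyalg_scale scalerDr. Qed.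

Fact polyalg_scalerDl p : {morph polyalg_scale^~ p : c d / c + d}.
Proof. by move=> c d; rewrite /polyalg_scale !scalerDl. Qed.

HB.instance Definition _ := GRing.Zmodule_isLmodule.Build k (polyalg A)
  polyalg_scalerA polyalg_scale1r polyalg_scalerDr polyalg_scalerDl.

Fact polyalg_scalerAl (c : k) (p q : polyalg A) : c *: (p * q) = (c *: p) * q.
Proof. exact: (@scalerAl A {poly A}). Qed.

HB.instance Definition _ := GRing.Lmodule_isLalgebra.Build k (polyalg A)
  polyalg_scalerAl.

Fact polyalg_scalerAr (c : k) (p q : polyalg A) : c *: (p * q) = p * (c *: q).
Proof.
rewrite /GRing.scale /= /polyalg_scale -!mul_polyC !mulrA; congr (_ * _).
apply/polyP => i; rewrite coefCM coefMC.
by rewrite -scalerAl mul1r -scalerAr mulr1.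
Qed.

HB.instance Definition _ := GRing.Lalgebra_isAlgebra.Build k (polyalg A)
  polyalg_scalerAr.

End PolyAlg.

(* A[t_1, ..., t_n], obtained by adjoining the central indeterminates one after
   the other. *)
Fixpoint mpolyalg (k : fieldType) (A : algType k) (n : nat) : algType k :=
  if n is m.+1 then polyalg (mpolyalg A m) else A.

Definition hopfian (k : fieldType) (A : algType k) : Prop :=
  forall f : {lrmorphism A -> A}, (forall y, exists x, f x = y) -> bijective f.

Definition strongly_hopfian (k : fieldType) (A : algType k) : Prop :=
  forall n : nat, hopfian (mpolyalg A n).

Section Center.

Variable R : nzRingType.

Definition central : pred R := fun a => `[< forall x, a * x = x * a >].

Lemma centralP (a : R) : reflect (forall x, a * x = x * a) (a \in central).
Proof. exact: asboolP. Qed.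

Fact central_subring : subring_closed central.
Proof.
split=> [|a b /centralP ca /centralP cb|a b /centralP ca /centralP cb].
- by apply/centralP => x; rewrite mul1r mulr1.
- by apply/centralP => x; rewrite mulrBl mulrBr ca cb.
- by apply/centralP => x; rewrite -mulrA cb !mulrA ca.
Qed.

HB.instance Definition _ := GRing.isSubringClosed.Build R central
  central_subring.

Record center := Center { center_val : R; _ : center_val \in central }.

HB.instance Definition _ := [isSub for center_val].
HB.instance Definition _ := [Choice of center by <:].
HB.instance Definition _ := [SubChoice_isSubNzRing of center by <:].

Fact center_mulrC : commutative (@GRing.mul center).
Proof.
by move=> a b; apply: val_inj; rewrite !rmorphM; apply: (centralP _ (valP a)).
Qed.

HB.instance Definition _ := GRing.PzRing_hasCommutativeMul.Build center
  center_mulrC.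

End Center.

Definition is_ideal (R : comNzRingType) (I : set R) : Prop :=
  [/\ I 0, forall x y, I x -> I y -> I (x + y) & forall a x, I x -> I (a * x)].

Definition artinian (R : comNzRingType) : Prop :=
  forall I : nat -> set R,
    (forall n, is_ideal (I n)) -> (forall n, I n.+1 `<=` I n) ->
    exists n, forall m, (n <= m)%N -> I m = I n.

Definition morita_cancellative (k : fieldType) (A : algType k) : Prop :=
  forall B : algType k,
    equivalent (right_modules (polyalg A)) (right_modules (polyalg B)) ->
    equivalent (right_modules A) (right_modules B).

(* Main.v *)
From HB Require Import structures.
From mathcomp Require Import all_boot all_algebra ring_quotient.
From mathcomp Require Import boolp classical_sets ring.
Require Import Defs.

(** Let Z and Y be the centers of A and B. The center of a ring is the ring of
    natural endomorphisms of the identity functor on its modules, and an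
    equivalence of module categories is additive; so an equivalence between
    the modules over A[t] and over B[t] induces a ring isomorphism of centers
    Z[t] -> Y[t] ([equivalence_center]). It is an isomorphism of rings only:
    nothing makes it linear over the base field.

    Let f in Y[t] be the image of t. The key claim is that B[t]/(f) is B. As Z
    is artinian, each z in Z satisfies z^n = z^(n+1) y for some n and y. Map Y
    to a domain D. Then Z[t] -> Y[t] -> D[t] sends z to 0 or to a unit, hence
    to a constant. So t, which lies in the image of the surjection, is a
    polynomial with coefficients in D in the image of f, and counting degrees
    shows that the image of f in D[t] has degree 1
    ([surjective_residually_linear]). As this holds for every D, the
    coefficient of t in f is a unit and the higher ones are nilpotent, because
    units and nilpotents are detected by the maps to domains
    ([unit_residueP], [nilpotent_residueP]). Newton iteration then finds a
    root r of f in Y, and f is t - r times a unit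
    ([residually_linear_factor]).

    An A[t]-module M is thus killed by t if and only if its image under the
    equivalence is killed by f, that is, by t - r. The modules of the first
    kind are those restricted along t |-> 0 from A, those of the second kind
    are those restricted along t |-> r from B ([annihilator_restriction]).
    Both restriction functors are fully faithful, so the modules over A and
    over B are identified with the same full subcategory of B[t]-modules
    ([common_image_equivalent]). *)

Set Implicit Arguments.
Unset Strict Implicit.
Unset Printing Implicit Defensive.

Import GRing.Theory.

Local Open Scope ring_scope.
Local Open Scope classical_set_scope.

(** * Residues of commutative rings in domains *)

(** A separate name for the quotient, so that the classical inverse below, which
    turns it into a domain, does not become an instance on every quotient. *)
Definition prime_quot (R : comNzRingType) (I : prime_idealr R) : Type :=
  {ideal_quot I}.

Section PrimeQuotient.

Variables (R : comNzRingType) (I : prime_idealr R).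

HB.instance Definition _ := GRing.ComNzRing.on (prime_quot I).

Let unit (x : prime_quot I) : bool := `[< exists y, y * x = 1 >].
Let inv (x : prime_quot I) : prime_quot I :=
  if pselect (exists y, y * x = 1) is left ex then projT1 (cid ex) else x.

Fact prime_quot_mulVr : {in unit, left_inverse 1 inv *%R}.
Proof.
move=> x /asboolP ex; rewrite /inv; case: pselect => // ex'.
by case: (cid ex').
Qed.

Fact prime_quot_unitP (x y : prime_quot I) : y * x = 1 -> unit x.
Proof. by move=> yx; apply/asboolP; exists y. Qed.

Fact prime_quot_inv_out : {in [predC unit], inv =1 id}.
Proof. by move=> x /asboolPn nex; rewrite /inv; case: pselect. Qed.

HB.instance Definition _ := GRing.ComNzRing_hasMulInverse.Build (prime_quot I)
  prime_quot_mulVr prime_quot_unitP prime_quot_inv_out.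

HB.instance Definition _ := GRing.ComUnitRing_isIntegral.Build (prime_quot I)
  (@Quotient.rquot_IdomainAxiom R I).

Definition prime_proj : {rmorphism R -> prime_quot I} :=
  \pi_{ideal_quot I}%qT.

Lemma prime_proj_eq0 a : (prime_proj a == 0) = (a \in I).
Proof.
by rewrite -[a in RHS]subr0 Quotient.idealrBE -(rmorph0 prime_proj).
Qed.

End PrimeQuotient.

Lemma prime_ideal_residue (R : comNzRingType) (P : set R) :
  is_ideal P -> ~ P 1 -> (forall a b, P (a * b) -> P a \/ P b) ->
  exists (D : idomainType) (th : {rmorphism R -> D}),
    forall a, th a = 0 <-> P a.
Proof.
move=> [P0 PD PM] P1 Pprime.
pose J : pred R := fun a => `[< P a >].
have inJ a : (a \in J) = `[< P a >] by [].
have idJ : idealr_closed J.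
  split; first exact/asboolP; first exact/asboolPn.
  by move=> a x y /asboolP Px /asboolP Py; apply/asboolP/PD => //; apply: PM.
have prJ : prime_idealr_closed J.
  by move=> a b /asboolP/Pprime[] Pa; apply/orP; [left|right]; apply/asboolP.
pose B0 := isIdealr.Build R J idJ.
pose B1 := isPrimeIdealrClosed.Build R J prJ.
pose I : prime_idealr R := HB.pack J B0 B1.
exists (prime_quot I), (@prime_proj R I) => a.
split=> [/eqP|Pa]; first by rewrite prime_proj_eq0 inJ => /asboolP.
by apply/eqP; rewrite prime_proj_eq0 inJ; apply/asboolP.
Qed.

(** By Zorn, an ideal containing I and maximal among those avoiding the powers
    of x exists. It is prime: if a and b lie outside, then both ideals enlarged
    by a and by b meet the powers of x, and so does the one enlarged by ab. *)
Lemma ideal_residue (R : comNzRingType) (I : set R) (x : R) :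
  is_ideal I -> (forall n, ~ I (x ^+ n)) ->
  exists (D : idomainType) (th : {rmorphism R -> D}),
    (forall a, I a -> th a = 0) /\ th x != 0.
Proof.
move=> idI Ix.
(* The empty chain has the empty union, which is no ideal: hence the condition
   is put on the union of J with I rather than on J. *)
pose good (J : set R) :=
  is_ideal (I `|` J) /\ forall n, ~ (I `|` J) (x ^+ n).
have [F Fgood Ftot|J [[[J0 JD JM] Jx] Jmax]] := @Zorn_bigcup R good.
  split; last first.
    by move=> n [/Ix//|[K /Fgood[_ Kx] Kxn]]; apply: (Kx n); right.
  have [I0 ID IM] := idI; split=> [|a b|a b]; first by left.
    have inF K c : F K -> (I `|` K) c -> (I `|` \bigcup_(X in F) X) c.
      by move=> FK [|Kc]; [left|right; exists K].
    move=> [Ia|[K FK Ka]] [Ib|[L FL Lb]].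
    - by left; apply: ID.
    - have [[_ LD _] _] := Fgood _ FL.
      by apply: (inF L) => //; apply: LD; [left|right].
    - have [[_ KD _] _] := Fgood _ FK.
      by apply: (inF K) => //; apply: KD; [right|left].
    - have [KL|LK] := Ftot _ _ FK FL.
        have [[_ LD _] _] := Fgood _ FL.
        by apply: (inF L) => //; apply: LD; right => //; apply: KL.
      have [[_ KD _] _] := Fgood _ FK.
      by apply: (inF K) => //; apply: KD; right => //; apply: LK.
  move=> [Ib|[K FK Kb]]; first by left; apply: IM.
  have [[_ _ KM] _] := Fgood _ FK.
  have [|Kab] := KM a b (or_intror Kb); first by left.
  by right; exists K.
pose P := I `|` J.
have Pmax a : ~ P a -> exists n p c, P p /\ x ^+ n = p + c * a.
  move=> Pa; pose K : set R := [set y | exists p c, P p /\ y = p + c * a].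
  have PK y : P y -> K y by move=> Py; exists y, 0; rewrite mul0r addr0.
  have IK : I `|` K = K.
    by apply/seteqP; split=> [y [Iy|//]|y Ky]; [apply: PK; left|right].
  apply/not_existsP => noK; apply: (Jmax K).
    split; first by move=> y Jy; apply: PK; right.
    move=> KJ; apply: Pa; right; apply: KJ; exists 0, 1.
    by rewrite mul1r add0r.
  rewrite /good IK; split; last first.
    by move=> n [p [c pc]]; apply: (noK n); exists p, c.
  split; first exact: PK.
    move=> _ _ [p [c [Pp ->]]] [q [d [Pq ->]]].
    exists (p + q), (c + d); split; first exact: JD.
    by rewrite mulrDl addrACA.
  move=> b _ [p [c [Pp ->]]]; exists (b * p), (b * c).
  by split; [apply: JM|rewrite mulrDr mulrA].
have [||a b Pab|D [th thP]] := @prime_ideal_residue R P.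
- by split.
- by have := Jx 0; rewrite expr0.
- apply: contrapT => /not_orP[].
  move=> /Pmax[n [p [c [Pp xn]]]] /Pmax[m [q [d [Pq xm]]]].
  apply: (Jx (n + m)); rewrite exprD xn xm mulrDl -/P.
  have PMr u v : P u -> P (u * v) by rewrite mulrC; apply: JM.
  apply: (JD); first exact: PMr.
  rewrite mulrDr; apply: JD; first exact: JM.
  by rewrite mulrACA; apply: JM.
- exists D, th; split=> [a Ia|]; first by apply/thP; left.
  by apply/eqP => /thP; have := Jx 1; rewrite expr1.
Qed.

(** A non-unit generates a proper ideal, which some map to a domain kills. *)
Lemma unit_residueP (R : comNzRingType) (x : R) :
  (forall (D : idomainType) (th : {rmorphism R -> D}), th x != 0) ->
  exists y, x * y = 1.
Proof.
move=> x_neq0; apply: contrapT => no_inv.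
have [||D [th [thx]]] := @ideal_residue R [set a | exists y, a = x * y] 1.
- split=> [|_ _ [a ->] [b ->]|a _ [b ->]].
  + by exists 0; rewrite mulr0.
  + by exists (a + b); rewrite mulrDr.
  + by exists (a * b); rewrite mulrCA.
- by move=> n [y]; rewrite expr1n => xy; apply: no_inv; exists y.
- by have := x_neq0 D th; rewrite thx ?eqxx //; exists 1; rewrite mulr1.
Qed.

Lemma nilpotent_residueP (R : comNzRingType) (x : R) :
  (forall (D : idomainType) (th : {rmorphism R -> D}), th x = 0) ->
  exists n, x ^+ n = 0.
Proof.
move=> x_eq0; apply: contrapT => /forallNP x_neq0.
have [|//|D [th [_]]] := @ideal_residue R [set 0] x.
  split=> // [_ _ -> ->|a _ ->]; first exact: addr0.
  exact: mulr0.
by rewrite x_eq0 eqxx.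
Qed.

(** * Polynomials that are linear in every residue domain *)

(** Equivalently, the coefficient of 'X is a unit and all higher ones are
    nilpotent. *)
Definition residually_linear (R : comNzRingType) (f : {poly R}) : Prop :=
  forall (D : idomainType) (th : {rmorphism R -> D}),
    size (map_poly th f) = 2%N.

(** Strong pi-regularity, which for commutative rings means Krull dimension
    zero. *)
Definition pi_regular (R : comNzRingType) : Prop :=
  forall z : R, exists n y, z ^+ n = z ^+ n.+1 * y.

(** The chain of the ideals generated by the powers of z stabilizes. *)
Lemma artinian_pi_regular (R : comNzRingType) : artinian R -> pi_regular R.
Proof.
move=> artR z.
have [||n stable] := artR (fun n => [set a | exists b, a = z ^+ n * b]).
- move=> n; split=> [|_ _ [a ->] [b ->]|a _ [b ->]].
  + by exists 0; rewrite mulr0.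
  + by exists (a + b); rewrite mulrDr.
  + by exists (a * b); rewrite mulrCA.
- by move=> n _ [b ->]; exists (z * b); rewrite exprSr mulrA.
have zn : [set a | exists b, a = z ^+ n * b] (z ^+ n).
  by exists 1; rewrite mulr1.
move: zn; rewrite -(stable n.+1) // => -[y zy].
by exists n, y.
Qed.

(** In a domain z^n (1 - z y) = 0 forces z to be 0 or a unit, and the units of
    D[t] are constants. *)
Lemma pi_regular_constant (Z : comNzRingType) (D : idomainType)
    (g : {rmorphism Z -> {poly D}}) (z : Z) :
  pi_regular Z -> g z = ((g z)`_0)%:P.
Proof.
move=> /(_ z)[n [y /(congr1 g)/eqP]]; rewrite rmorphM !rmorphXn.
rewrite -subr_eq0 exprSr -mulrA -{1}[g z ^+ n]mulr1 -mulrBr mulf_eq0.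
case/orP=> [|/eqP zy1].
  by rewrite expf_eq0 => /andP[_ /eqP->]; rewrite coef0.
apply: size1_polyC; rewrite leq_eqVlt; apply/orP; left.
have: g z * g y = 1 by apply/esym/subr0_eq.
move=> zy; have: g z \is a GRing.unit by apply/unitrPr; exists (g y).
by rewrite poly_unitE => /andP[].
Qed.

(** With the coefficients of Z[t] sent to constants, a preimage of t writes t as
    the composition of a polynomial h with the image of psi 'X; degrees
    multiply under composition. *)
Lemma surjective_residually_linear (Z Y : comNzRingType)
    (psi : {rmorphism {poly Z} -> {poly Y}}) :
  pi_regular Z -> (forall p, exists q, psi q = p) ->
  residually_linear (psi 'X).
Proof.
move=> regZ psi_surj D th.
pose g : {rmorphism {poly Z} -> {poly D}} := map_poly th \o psi.
have gC z : g z%:P = ((g z%:P)`_0)%:P.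
  exact: (@pi_regular_constant _ _ (g \o polyC)).
have [q psi_q] := psi_surj 'X.
pose h := \poly_(i < size q) (g (q`_i)%:P)`_0.
have X_comp : 'X = h \Po g 'X.
  transitivity (g q); first by rewrite /g /= psi_q map_polyX.
  rewrite -[q in LHS]coefK poly_def /h poly_def (rmorph_sum g) linear_sum.
  apply: eq_bigr => i _.
  rewrite [RHS]comp_polyZ comp_Xn_poly -!mul_polyC -gC.
  by rewrite (rmorphM g) (rmorphXn g).
have := size_comp_poly h (g 'X); rewrite -X_comp size_polyX /=.
move/esym/eqP; rewrite muln_eq1 => /andP[_]; rewrite /g /=.
by case: size => // n /eqP/= ->.
Qed.

Lemma horner_taylor1 (R : comNzRingType) (f : {poly R}) (r h : R) :
  exists c, f.[r + h] = f.[r] + f^`().[r] * h + h ^+ 2 * c.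
Proof.
elim/poly_ind: f => [|p a [c IHp]].
  by exists 0; rewrite deriv0 !horner0 mul0r mulr0 !addr0.
exists (p^`().[r] + r * c + h * c).
rewrite derivD derivM derivX derivC mulr1 addr0 !hornerE IHp; ring.
Qed.

Lemma residually_linear_coef1 (R : comNzRingType) (f : {poly R}) :
  residually_linear f -> exists u, f`_1 * u = 1.
Proof.
move=> lin; apply: unit_residueP => D th.
have := lin D th; case: (eqVneq (map_poly th f) 0) => [->|].
  by rewrite size_poly0.
by rewrite -lead_coef_eq0 lead_coefE => + size2; rewrite size2 coef_map.
Qed.

Lemma residually_linear_deriv (R : comNzRingType) (f : {poly R}) (r : R) :
  residually_linear f -> exists u, f^`().[r] * u = 1.
Proof.
move=> lin; apply: unit_residueP => D th.
rewrite -horner_map -deriv_map.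
have size2 := lin D th; set p := map_poly th f in size2 *.
have: p != 0 by rewrite -size_poly_eq0 size2.
rewrite -lead_coef_eq0 lead_coefE size2 => p1.
have -> : p^`() = (p`_1)%:P.
  apply/polyP => i; rewrite coef_deriv coefC.
  case: i => [|i] //=; rewrite nth_default ?mul0rn // size2 //.
by rewrite hornerC.
Qed.

(** Newton iteration. The derivative of f is a unit everywhere, so r can be
    replaced by r - f(r)/f'(r), where the value of f is a multiple of f(r)^2;
    a nilpotent value thus becomes 0 after finitely many steps. The root of the
    linear part of f is a starting point: f takes there the value 0 in every
    residue domain. *)
Lemma residually_linear_root (R : comNzRingType) (f : {poly R}) :
  residually_linear f -> exists r, root f r.
Proof.
move=> lin.
have newton m r : f.[r] ^+ m.+1 = 0 -> exists s, root f s.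
  elim: m r => [|m IHm] r; first by rewrite expr1 => fr; exists r; apply/eqP.
  move=> fr; have [u f'u] := residually_linear_deriv r lin.
  have [c taylor] := horner_taylor1 f r (- (f.[r] * u)).
  apply: (IHm (r - f.[r] * u)); rewrite taylor.
  have -> : f.[r] + f^`().[r] * - (f.[r] * u) + (- (f.[r] * u)) ^+ 2 * c
      = f.[r] ^+ 2 * (u ^+ 2 * c) + (1 - f^`().[r] * u) * f.[r] by ring.
  rewrite f'u subrr mul0r addr0 exprMn -exprM mul2n -addnn addSnnS exprD.
  by rewrite fr mulr0 mul0r.
have [u fu] := residually_linear_coef1 lin.
have [|n fr] := @nilpotent_residueP R f.[- f`_0 * u].
  move=> D th; rewrite -horner_map horner_coef lin !big_ord_recl big_ord0.
  rewrite !coef_map expr0 mulr1 addr0 -rmorphM -rmorphD.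
  rewrite mulNr mulrN mulrCA -[f`_(lift _ _)]/(f`_1) fu mulr1.
  by rewrite subrr rmorph0.
by apply: (newton n (- f`_0 * u)); rewrite exprS fr mulr0.
Qed.

(** The cofactor w is a unit of R[t]. Let th be a map from R[t] to a domain D.
    Over D, the linear f is the product of a linear polynomial with w, so w
    becomes a nonzero constant in D[t]; evaluation at th 'X, which gives back
    th w, does not change it. *)
Lemma residually_linear_factor (R : comNzRingType) (f : {poly R}) :
  residually_linear f ->
  exists r w w', f = w * ('X - r%:P) /\ w * w' = 1.
Proof.
move=> lin; have [r /factor_theorem[w f_def]] := residually_linear_root lin.
have [|w' ww'] := @unit_residueP {poly R} w; last by exists r, w, w'.
move=> D th; pose th0 : {rmorphism R -> D} := th \o polyC.
have -> : th w = (map_poly th0 w).[th 'X].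
  by rewrite -[w in LHS]comp_polyXr /comp_poly -horner_map /= -map_poly_comp.
have := lin D th0; rewrite f_def rmorphM rmorphB /= map_polyX map_polyC /=.
have [->|w0] := eqVneq (map_poly th0 w) 0; first by rewrite mul0r size_poly0.
rewrite size_Mmonic ?monicXsubC // size_XsubC addn2 /= => -[size1].
have /eqP/size_poly1P[c c0 ->] := size1.
by rewrite hornerC.
Qed.

(** * Categories with a common image *)

Definition faithful (C D : category) (F : functor C D) : Prop :=
  forall (X Y : obj C) (f g : hom X Y), fmap F f = fmap F g -> f = g.

Definition full (C D : category) (F : functor C D) : Prop :=
  forall (X Y : obj C) (h : hom (fobj F X) (fobj F Y)),
    exists f : hom X Y, fmap F f = h.

Definition isomorphic (C : category) (X Y : obj C) : Prop :=
  exists f : hom X Y, is_iso f.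

Lemma isomorphic_refl (C : category) (X : obj C) : isomorphic X X.
Proof. by exists (idm X), (idm X); rewrite comp1m. Qed.

Lemma isomorphic_sym (C : category) (X Y : obj C) :
  isomorphic X Y -> isomorphic Y X.
Proof. by move=> [f [g [gf fg]]]; exists g, f. Qed.

Lemma isomorphic_trans (C : category) (X Y Z : obj C) :
  isomorphic X Y -> isomorphic Y Z -> isomorphic X Z.
Proof.
move=> [f [f' [f'f ff']]] [g [g' [g'g gg']]].
exists (compm g f), (compm f' g'); split.
  by rewrite compmA -(compmA f') g'g compm1.
by rewrite compmA -(compmA g) ff' compm1.
Qed.

Lemma isomorphic_fobj (C D : category) (F : functor C D) (X Y : obj C) :
  isomorphic X Y -> isomorphic (fobj F X) (fobj F Y).
Proof.
move=> [f [g [gf fg]]]; exists (fmap F f), (fmap F g).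
by rewrite -!fmapM gf fg !fmap1.
Qed.

Lemma iso_monic (C : category) (X Y Z : obj C) (e : hom Y Z) (f g : hom X Y) :
  is_iso e -> compm e f = compm e g -> f = g.
Proof.
move=> [e' [e'e _]] /(congr1 (compm e')).
by rewrite !compmA e'e !comp1m.
Qed.

Lemma iso_epic (C : category) (X Y Z : obj C) (e : hom X Y) (f g : hom Y Z) :
  is_iso e -> compm f e = compm g e -> f = g.
Proof.
move=> [e' [_ ee']] /(congr1 (fun h => compm h e')).
by rewrite -!compmA ee' !compm1.
Qed.

Lemma retract_faithful (C D : category) (F : functor C D) (G : functor D C) :
  naturally_isomorphic (functor_comp G F) (functor_id C) -> faithful F.
Proof.
move=> [eta [nat iso]] X Y f g Ffg.
by apply: (iso_epic (iso X)); rewrite -!nat /= Ffg.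
Qed.

(** The preimage of h is G h conjugated by the isomorphisms G F X ~ X; by
    naturality G cannot distinguish its image from h. *)
Lemma equivalence_full (C D : category) (F : functor C D) (G : functor D C) :
  naturally_isomorphic (functor_comp G F) (functor_id C) -> faithful G ->
  full F.
Proof.
move=> [eta [nat iso]] Gf X Y h; have [e [eX Xe]] := iso X.
pose f : hom X Y := compm (eta Y) (compm (fmap G h) e).
exists f; apply: Gf; apply: (iso_monic (iso Y)).
by have := nat _ _ f => /= ->; rewrite /f -!compmA eX compm1.
Qed.

Lemma full_comp (C D E : category) (G : functor D E) (F : functor C D) :
  full G -> full F -> full (functor_comp G F).
Proof.
move=> Gf Ff X Y h; have [g <-] := Gf _ _ h.
by have [f <-] := Ff _ _ g; exists f.
Qed.

Lemma faithful_comp (C D E : category) (G : functor D E) (F : functor C D) :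
  faithful G -> faithful F -> faithful (functor_comp G F).
Proof. by move=> Gf Ff X Y f g /Gf/Ff. Qed.

Section IsoChoice.

Variables (C : category) (X Y : obj C) (XY : isomorphic X Y).

Definition iso_hom : hom X Y := sval (cid XY).
Definition iso_inv : hom Y X := sval (cid (svalP (cid XY))).

Lemma iso_homK : compm iso_inv iso_hom = idm X.
Proof. exact: (svalP (cid (svalP (cid XY)))).1. Qed.

Lemma iso_invK : compm iso_hom iso_inv = idm Y.
Proof. exact: (svalP (cid (svalP (cid XY)))).2. Qed.

End IsoChoice.

(** The factorization of P through the fully faithful Q, once objects f X with
    Q (f X) isomorphic to P X have been chosen. *)
Section Lift.

Variables (C D E : category) (P : functor C E) (Q : functor D E).
Hypotheses (Q_full : full Q) (Q_faithful : faithful Q).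
Variables (f : obj C -> obj D).
Variable (e : forall X, isomorphic (fobj P X) (fobj Q (f X))).

Definition lift_map X Y (u : hom X Y) : hom (f X) (f Y) :=
  sval (cid (Q_full
    (compm (iso_hom (e Y)) (compm (fmap P u) (iso_inv (e X)))))).

Lemma lift_mapE X Y (u : hom X Y) :
  fmap Q (lift_map u) =
  compm (iso_hom (e Y)) (compm (fmap P u) (iso_inv (e X))).
Proof. exact: (svalP (cid (Q_full _))). Qed.

Fact lift_map1 X : lift_map (idm X) = idm (f X).
Proof. by apply: Q_faithful; rewrite lift_mapE !fmap1 comp1m iso_invK. Qed.

Fact lift_mapM X Y Z (u : hom Y Z) (v : hom X Y) :
  lift_map (compm u v) = compm (lift_map u) (lift_map v).
Proof.
apply: Q_faithful; rewrite fmapM !lift_mapE fmapM -!compmA; congr compm.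
by rewrite (compmA (iso_inv (e Y))) iso_homK comp1m.
Qed.

Definition lift_functor : functor C D := Functor lift_map1 lift_mapM.

End Lift.

Lemma lift_retract (C D E : category) (P : functor C E) (Q : functor D E)
    (P_full : full P) (P_faithful : faithful P)
    (Q_full : full Q) (Q_faithful : faithful Q)
    (f : obj C -> obj D) (e : forall X, isomorphic (fobj P X) (fobj Q (f X)))
    (g : obj D -> obj C) (d : forall Y, isomorphic (fobj Q Y) (fobj P (g Y))) :
  naturally_isomorphic
    (functor_comp (lift_functor P_full P_faithful d)
                  (lift_functor Q_full Q_faithful e))
    (functor_id C).
Proof.
have iso X : {u : hom (g (f X)) X |
    fmap P u = compm (iso_inv (e X)) (iso_inv (d (f X)))}.
  exact: cid (P_full _ _ _).
exists (fun X => sval (iso X)); split=> [X Y u|X].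
  apply: (P_faithful); rewrite /= !fmapM !(svalP (iso _)) !lift_mapE.
  rewrite -!compmA (compmA (iso_inv (d _))) iso_homK comp1m.
  by rewrite (compmA (iso_inv (e Y))) iso_homK comp1m.
have [h Ph] := P_full _ _ (compm (iso_hom (d (f X))) (iso_hom (e X))).
exists h; split; apply: (P_faithful); rewrite fmapM (svalP (iso _)) Ph fmap1.
  rewrite -compmA (compmA (iso_hom (e X))) iso_invK comp1m.
  exact: iso_invK.
rewrite -compmA (compmA (iso_inv (d _))) iso_homK comp1m.
exact: iso_homK.
Qed.

(** Two fully faithful functors with the same essential image have equivalent
    sources: each factors through the other, and the two factorizations are
    mutually inverse. *)
Lemma common_image_equivalent (C D E : category)
    (P : functor C E) (Q : functor D E) :
  full P -> faithful P -> full Q -> faithful Q ->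
  (forall X, exists Y, isomorphic (fobj P X) (fobj Q Y)) ->
  (forall Y, exists X, isomorphic (fobj Q Y) (fobj P X)) ->
  equivalent C D.
Proof.
move=> Pl Pf Ql Qf /choice[f e] /choice[g d].
exists (lift_functor Ql Qf e), (lift_functor Pl Pf d).
by split; apply: lift_retract.
Qed.

(** * Equivalences of module categories and centers *)

Definition linear_of (R : pzRingType) (M N : lmodType R) (f : M -> N)
    (f_lin : linear f) : {linear M -> N} :=
  HB.pack f (GRing.isLinear.Build R M N *:%R f f_lin).

(** The action of F on morphisms, typed so that the result applies to
    elements. *)
Definition lmap (R S : nzRingType)
    (F : functor (right_modules R) (right_modules S)) (M N : lmodType R^c)
    (f : {linear M -> N}) :
    {linear (fobj F M : lmodType S^c) -> (fobj F N : lmodType S^c)} :=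
  @fmap _ _ F M N f.

Section Additivity.

Variables (R S : nzRingType) (F : functor (right_modules R) (right_modules S)).
Hypotheses (F_full : full F) (F_faithful : faithful F).

Implicit Types M N P : lmodType R^c.

Lemma lmap_full M N
    (h : {linear (fobj F M : lmodType S^c) -> (fobj F N : lmodType S^c)}) :
  exists f : {linear M -> N}, lmap F f = h.
Proof. exact: F_full. Qed.

Lemma lmap_inj M N (f g : {linear M -> N}) : lmap F f =1 lmap F g -> f =1 g.
Proof. by move=> fg x; have /F_faithful -> := linear_funP fg. Qed.

Lemma lmap_id M x : lmap F (idfun : {linear M -> M}) x = x.
Proof.
exact: (congr1 (fun h : {linear _ -> _} => h x) (@fmap1 _ _ F M)).
Qed.

Lemma lmap_comp M N P (f : {linear N -> P}) (g : {linear M -> N}) x :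
  lmap F (f \o g) x = lmap F f (lmap F g x).
Proof.
exact: (congr1 (fun h : {linear _ -> _} => h x) (@fmapM _ _ F M N P f g)).
Qed.

Lemma lmap_ext M N (f g : {linear M -> N}) : f =1 g -> lmap F f =1 lmap F g.
Proof. by move=> /linear_funP->. Qed.

(** By fullness the zero map from F M to F N is some F u, and 0 = 0 u. *)
Lemma lmap0 M N x : lmap F (\0 : {linear M -> N}) x = 0.
Proof.
have [u Fu] := @lmap_full M N \0.
have /lmap_ext-> : (\0 : {linear M -> N}) =1 (\0 : {linear N -> N}) \o u by [].
by rewrite lmap_comp Fu linear0.
Qed.

(** A fully faithful functor is additive. The sum N x N -> N is the only map
    restricting to the identity on both copies of N. By fullness the sum of the
    images of the two projections is F s for some s; this s has that property,
    so it is the sum map. Composing with (f, g) gives the claim. *)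
Lemma lmapD M N (f g : {linear M -> N}) x :
  lmap F (f \+ g) x = lmap F f x + lmap F g x.
Proof.
pose NN : lmodType R^c := (N * N)%type.
have l1 : linear (fun y => (y, 0) : NN).
  by move=> a y z; apply/pair_equal_spec; rewrite /= scaler0 addr0.
have l2 : linear (fun y => (0, y) : NN).
  by move=> a y z; apply/pair_equal_spec; rewrite /= scaler0 addr0.
have lfg : linear (fun y => (f y, g y) : NN).
  by move=> a y z; rewrite !linearP.
pose p1 : {linear NN -> N} := fst; pose p2 : {linear NN -> N} := snd.
pose i1 := linear_of l1; pose i2 := linear_of l2; pose fg := linear_of lfg.
have [s Fs] := lmap_full (lmap F p1 \+ lmap F p2).
have s1 : s \o i1 =1 idfun.
  apply: lmap_inj => y; rewrite lmap_comp Fs /= -!lmap_comp lmap_id.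
  rewrite (@lmap_ext _ _ (p1 \o i1) idfun) // lmap_id.
  by rewrite (@lmap_ext _ _ (p2 \o i1) \0) // lmap0 addr0.
have s2 : s \o i2 =1 idfun.
  apply: lmap_inj => y; rewrite lmap_comp Fs /= -!lmap_comp lmap_id.
  rewrite (@lmap_ext _ _ (p2 \o i2) idfun) // lmap_id.
  by rewrite (@lmap_ext _ _ (p1 \o i2) \0) // lmap0 add0r.
have /lmap_ext-> : f \+ g =1 s \o fg.
  move=> y /=.
  have -> : (f y, g y) = i1 (f y) + i2 (g y) :> NN.
    by apply/pair_equal_spec; rewrite /= addr0 add0r.
  by rewrite linearD [s (i1 _)]s1 [s (i2 _)]s2.
by rewrite lmap_comp Fs /= -!lmap_comp; congr (_ + _); apply: lmap_ext.
Qed.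

End Additivity.

Section CentralAction.

Variables (R : nzRingType).

Section Act.
Variables (c : center R) (M : lmodType R^c).

Fact central_act_linear : linear (fun x : M => (val c : R^c) *: x).
Proof.
move=> a x y; rewrite scalerDr !scalerA; congr (_ *: _ + _).
by apply/esym; exact: (centralP _ (valP c)).
Qed.

Definition central_act : {linear M -> M} := linear_of central_act_linear.
End Act.

Lemma central_act_natural c (M N : lmodType R^c) (f : {linear M -> N}) x :
  f (central_act c M x) = central_act c N (f x).
Proof. exact: linearZ. Qed.

Lemma central_act_inj c d :
  (forall M, central_act c M =1 central_act d M) -> c = d.
Proof.
move=> /(_ R^c^o 1) /=; rewrite /GRing.scale/= => cd.
by apply: val_inj; have := cd; rewrite !mulr1.
Qed.

(** A natural endomorphism is determined by its value c at 1 in the regular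
    module, since every element of a module is the image of 1 under some map
    from the regular module; c is central because the value at the regular
    module is itself linear. *)
Lemma natural_endo_central
    (eta : forall M : lmodType R^c, {linear M -> M}) :
  (forall (M N : lmodType R^c) (f : {linear M -> N}) x,
     f (eta M x) = eta N (f x)) ->
  exists c, forall M, eta M =1 central_act c M.
Proof.
move=> nat.
pose c : R := eta R^c^o 1.
have evE (M : lmodType R^c) (m : M) : linear (fun a : R^c^o => (a : R^c) *: m).
  by move=> a x y; rewrite scalerDl scalerA.
have etaE (M : lmodType R^c) (m : M) : eta M m = (c : R^c) *: m.
  by have := nat _ _ (linear_of (evE M m)) 1; rewrite /= scale1r => ->.
have cc : c \in @central R.
  apply/centralP => a.
  have e1 : eta R^c^o a = a * c by exact: etaE.
  have := linearZ_LR (eta R^c^o) (a : R^c) 1.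
  by rewrite [_ *: 1]mulr1 e1 => ->.
by exists (Center cc) => M m; rewrite etaE.
Qed.

End CentralAction.

Definition corresponding (R S : nzRingType)
    (F : functor (right_modules R) (right_modules S))
    (c : center R) (s : center S) : Prop :=
  forall M : lmodType R^c,
    lmap F (central_act c M) =1 central_act s (fobj F M : lmodType S^c).

Section Correspondence.

Variables (R S : nzRingType).

(** The action of s on the modules F M is natural, so its preimages under F are
    natural as well, and come from a central element. *)
Lemma corresponding_exists (F : functor (right_modules R) (right_modules S)) s :
  full F -> faithful F -> exists c, corresponding F c s.
Proof.
move=> F_full F_faithful.
have pre (M : lmodType R^c) : {u : {linear M -> M} |
    lmap F u = central_act s (fobj F M : lmodType S^c)}.
  exact: cid (F_full _ _ _).
have [|c cE] := @natural_endo_central R (fun M => sval (pre M)).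
  move=> M N f x.
  apply: (lmap_inj F_faithful
    (f := f \o sval (pre M)) (g := sval (pre N) \o f)).
  by move=> y; rewrite !lmap_comp !(svalP (pre _)) central_act_natural.
by exists c => M x; rewrite -(svalP (pre M)); apply: lmap_ext => y; rewrite cE.
Qed.

(** It suffices to compare after applying G, where both actions become the
    action of c: one by hypothesis, the other by naturality of G F ~ id and
    centrality of c. *)
Lemma corresponding_inverse (F : functor (right_modules R) (right_modules S))
    (G : functor (right_modules S) (right_modules R)) c s :
  naturally_isomorphic (functor_comp G F) (functor_id _) ->
  faithful G -> corresponding G s c -> corresponding F c s.
Proof.
move=> [eta [nat iso]] G_faithful sc M.
apply: (lmap_inj G_faithful) => x; rewrite sc.
have [e [eK _]] := iso M.
pose h : {linear (fobj G (fobj F M) : lmodType R^c) -> M} := eta M.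
pose h' : {linear M -> (fobj G (fobj F M) : lmodType R^c)} := e.
have hK y : h' (h y) = y.
  exact: (congr1 (fun u : {linear _ -> _} => u y) eK).
have natE y : h (lmap G (lmap F (central_act c M)) y) = central_act c M (h y).
  exact: (congr1 (fun u : {linear _ -> _} => u y) (nat M M (central_act c M))).
by rewrite -[LHS]hK natE -central_act_natural hK.
Qed.

Variable F : functor (right_modules R) (right_modules S).
Hypotheses (F_full : full F) (F_faithful : faithful F).

Lemma corresponding_uniq c s t :
  (forall N, exists M, isomorphic (fobj F M) N) ->
  corresponding F c s -> corresponding F c t -> s = t.
Proof.
move=> F_surj cs ct; apply: central_act_inj => N x.
have [M [e [e' [_ ee']]]] := F_surj N.
pose h : {linear (fobj F M : lmodType S^c) -> N} := e.
pose h' : {linear N -> (fobj F M : lmodType S^c)} := e'.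
have hK : h (h' x) = x.
  exact: (congr1 (fun u : {linear _ -> _} => u x) ee').
by rewrite -hK -!(central_act_natural _ h) -cs ct.
Qed.

Lemma corresponding0 : corresponding F 0 0.
Proof.
move=> M x; rewrite [RHS]scale0r -(@lmap0 _ _ F F_full M M x).
by apply: lmap_ext => y; apply: scale0r.
Qed.

Lemma corresponding1 : corresponding F 1 1.
Proof.
move=> M x; rewrite [RHS]scale1r -[RHS](@lmap_id _ _ F M).
by apply: lmap_ext => y; apply: scale1r.
Qed.

Lemma correspondingD c d s t :
  corresponding F c s -> corresponding F d t -> corresponding F (c + d) (s + t).
Proof.
move=> cs dt M x.
have -> : central_act (s + t) (fobj F M : lmodType S^c) x =
    central_act s _ x + central_act t _ x by apply: scalerDl.
rewrite -cs -dt -(lmapD F_full F_faithful).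
by apply: lmap_ext => y; apply: scalerDl.
Qed.

Lemma correspondingM c d s t :
  corresponding F c s -> corresponding F d t -> corresponding F (c * d) (s * t).
Proof.
move=> cs dt M x.
have -> : central_act (s * t) _ x =
    central_act s _ (central_act t (fobj F M : lmodType S^c) x).
  by rewrite mulrC /= scalerA.
rewrite -dt -cs -lmap_comp; apply: lmap_ext => y.
by rewrite mulrC /= scalerA.
Qed.

End Correspondence.

(** The functor in one direction yields the preimages under phi, its
    quasi-inverse the values of phi. *)
Lemma equivalence_center (R S : nzRingType) :
  equivalent (right_modules R) (right_modules S) ->
  exists F : functor (right_modules R) (right_modules S),
    [/\ full F, faithful F & forall N, exists M, isomorphic (fobj F M) N] /\
    exists phi : {rmorphism center R -> center S},
      (forall s, exists c, phi c = s) /\ forall c, corresponding F c (phi c).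
Proof.
move=> [F [G [GF FG]]]; exists F.
have F_faithful := retract_faithful GF; have G_faithful := retract_faithful FG.
have F_full := equivalence_full GF G_faithful.
have G_full := equivalence_full FG F_faithful.
have F_surj N : exists M, isomorphic (fobj F M) N.
  by exists (fobj G N); have [eta [_ iso]] := FG; exists (eta N); apply: iso.
split=> //.
have /choice[phi phiP] c : exists s, corresponding F c s.
  have [s sc] := corresponding_exists c G_full G_faithful.
  by exists s; apply: corresponding_inverse sc.
have phiE c s : corresponding F c s -> phi c = s.
  exact: corresponding_uniq.
have phiD : nmod_morphism phi.
  split=> [|c d]; apply: phiE; first exact: corresponding0.
  exact: correspondingD.
have phiM : monoid_morphism phi.
  split=> [|c d]; apply: phiE; first exact: corresponding1.
  exact: correspondingM.
pose phi' : {rmorphism center R -> center S} := HB.pack phi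
  (GRing.isNmodMorphism.Build _ _ phi phiD)
  (GRing.isMonoidMorphism.Build _ _ phi phiM).
exists phi'; split=> // s.
have [c cs] := corresponding_exists s F_full F_faithful.
by exists c; apply: phiE.
Qed.

Lemma central_actM (R : nzRingType) (c d : center R) (M : lmodType R^c)
    (x : M) :
  central_act (c * d) M x = central_act c M (central_act d M x).
Proof. by rewrite mulrC /= scalerA. Qed.

Lemma corresponding_kill (R S : nzRingType)
    (F : functor (right_modules R) (right_modules S)) (c : center R)
    (s : center S) (M : lmodType R^c) :
  full F -> faithful F -> corresponding F c s ->
  (forall x, central_act c M x = 0) <->
  (forall y, central_act s (fobj F M : lmodType S^c) y = 0).
Proof.
move=> F_full F_faithful cs; split=> [c0 y|s0].
  rewrite -cs (@lmap_ext _ _ F M M (central_act c M) \0) //.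
  exact: lmap0.
apply: (lmap_inj F_faithful (g := \0)) => y.
by rewrite cs s0 lmap0.
Qed.

(** * Restriction of scalars *)

Definition restricted (R S : nzRingType) (pi : {rmorphism R -> S})
  (M : lmodType S^c) : Type := M.

Section Restriction.

Variables (R S : nzRingType) (pi : {rmorphism R -> S}).

Section Objects.

Variable M : lmodType S^c.

HB.instance Definition _ := GRing.Zmodule.on (restricted pi M).

Definition restricted_scale (a : R^c) (x : restricted pi M) :
  restricted pi M := (pi a : S^c) *: (x : M).

Fact restricted_scalerA a b x :
  restricted_scale a (restricted_scale b x) = restricted_scale (a * b) x.
Proof. by rewrite /restricted_scale scalerA [pi (a * b)]rmorphM. Qed.

Fact restricted_scale1r : left_id 1 restricted_scale.
Proof. by move=> x; rewrite /restricted_scale rmorph1 scale1r. Qed.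

Fact restricted_scalerDr : right_distributive restricted_scale +%R.
Proof. by move=> a x y; apply: scalerDr. Qed.

Fact restricted_scalerDl x : {morph restricted_scale^~ x : a b / a + b}.
Proof. by move=> a b; rewrite /restricted_scale rmorphD scalerDl. Qed.

HB.instance Definition _ := GRing.Zmodule_isLmodule.Build R^c (restricted pi M)
  restricted_scalerA restricted_scale1r restricted_scalerDr
  restricted_scalerDl.

Lemma restricted_scaleE (a : R) (x : restricted pi M) :
  (a : R^c) *: x = ((pi a : S^c) *: (x : M)).
Proof. by []. Qed.

End Objects.

Fact restricted_linear (M N : lmodType S^c) (f : {linear M -> N}) :
  linear (f : restricted pi M -> restricted pi N).
Proof. by move=> a x y; rewrite !restricted_scaleE linearP. Qed.

Let resmap (M N : lmodType S^c) (f : {linear M -> N}) :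
  {linear restricted pi M -> restricted pi N} :=
  linear_of (@restricted_linear M N f).

Fact resmap1 (M : lmodType S^c) :
  resmap (idfun : {linear M -> M}) = (idfun : {linear restricted pi M -> _}).
Proof. exact: linear_funP. Qed.

Fact resmapM (M N P : lmodType S^c)
    (f : {linear N -> P}) (g : {linear M -> N}) :
  resmap (f \o g) = (resmap f \o resmap g : {linear restricted pi M -> _}).
Proof. exact: linear_funP. Qed.

Definition restriction : functor (right_modules S) (right_modules R) :=
  @Functor (right_modules S) (right_modules R)
    (fun M : lmodType S^c => restricted pi M : lmodType R^c)
    resmap resmap1 resmapM.

Lemma restriction_faithful : faithful restriction.
Proof.
move=> M N f g fg; apply: linear_funP => x.
pose ap (u : {linear restricted pi M -> restricted pi N}) := u x.
exact: (congr1 ap fg).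
Qed.

Lemma restriction_full : (forall s, exists r, pi r = s) -> full restriction.
Proof.
move=> pi_surj M N h.
have lin : linear ((h : {linear restricted pi M -> restricted pi N}) : M -> N).
  move=> s x y; have [r <-] := pi_surj s.
  exact: (linearP (h : {linear restricted pi M -> restricted pi N}) (r : R^c)).
by exists (linear_of lin); apply: linear_funP.
Qed.

End Restriction.

(** Restrict M along iota, then along pi: the resulting action of a is that of
    iota (pi a), which differs from a by an element of the kernel of pi. *)
Lemma restriction_image (R S : nzRingType) (pi : {rmorphism R -> S})
    (iota : {rmorphism S -> R}) (M : lmodType R^c) :
  cancel iota pi ->
  (forall (a : R) (x : M), pi a = 0 -> (a : R^c) *: x = 0) ->
  exists N : lmodType S^c,
    @isomorphic (right_modules R) M (fobj (restriction pi) N).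
Proof.
move=> iotaK ker0.
pose N : lmodType S^c := restricted iota M.
pose resN : lmodType R^c := restricted pi N.
have scaleE (a : R) (x : M) : (iota (pi a) : R^c) *: x = (a : R^c) *: x.
  apply/eqP; rewrite -subr_eq0 -scalerBl; apply/eqP/ker0.
  by rewrite [pi _](rmorphB pi) iotaK subrr.
have to_lin : linear (id : M -> resN).
  by move=> a x y; rewrite restricted_scaleE -(scaleE a x).
have from_lin : linear (id : resN -> M).
  by move=> a x y; rewrite restricted_scaleE -(scaleE a x).
exists N, (linear_of to_lin), (linear_of from_lin).
by split; apply: linear_funP.
Qed.

(** * Polynomial rings: center, evaluation, annihilated modules *)

Section PolyCenter.

Variable A : nzRingType.

Lemma central_polyP (p : {poly A}) :
  p \in @central {poly A} <-> forall i, p`_i \in @central A.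
Proof.
split=> [/centralP pC i|pC].
  apply/centralP => a; have /polyP/(_ i) := pC a%:P.
  by rewrite coefMC coefCM.
apply/centralP => q; apply/polyP => i; rewrite coefM coefMr.
by apply: eq_bigr => j _; have /centralP-> := pC j.
Qed.

Fact lift_center_subproof (q : {poly center A}) :
  map_poly val q \in @central {poly A}.
Proof. by apply/central_polyP => i; rewrite coef_map; apply: valP. Qed.

(** The inclusion of Z[t], for Z the center of A, into the center of A[t]; the
    lemmas below show that it is an isomorphism. *)
Definition lift_center (q : {poly center A}) : center {poly A} :=
  Center (lift_center_subproof q).

Lemma lift_centerE q : val (lift_center q) = map_poly val q.
Proof. by []. Qed.

Lemma lift_center_XsubC r : val (lift_center ('X - r%:P)) = 'X - (val r)%:P.
Proof. exact: (map_polyXsubC val). Qed.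

Fact lift_center_nmod : nmod_morphism lift_center.
Proof.
split=> [|p q]; apply: val_inj.
  by rewrite lift_centerE rmorph0.
by rewrite lift_centerE rmorphD.
Qed.

Fact lift_center_monoid : monoid_morphism lift_center.
Proof.
split=> [|p q]; apply: val_inj.
  by rewrite lift_centerE rmorph1.
by rewrite lift_centerE rmorphM.
Qed.

HB.instance Definition _ := GRing.isNmodMorphism.Build _ _ lift_center
  lift_center_nmod.
HB.instance Definition _ := GRing.isMonoidMorphism.Build _ _ lift_center
  lift_center_monoid.

Lemma lift_center_inj : injective lift_center.
Proof.
move=> p q /(congr1 val)/= pq; apply/polyP => i; apply: val_inj.
by rewrite -!coef_map pq.
Qed.

Lemma lift_center_surj c : exists q, lift_center q = c.
Proof.
exists (\poly_(i < size (val c)) insubd 0 (val c)`_i); apply: val_inj.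
apply/polyP => i; rewrite lift_centerE coef_map coef_poly.
case: ltnP => [_|/leq_sizeP-> //].
apply: insubdK; exact: (central_polyP _).1 (valP c) i.
Qed.

Lemma lift_center_inverse :
  exists low : {rmorphism center {poly A} -> {poly center A}},
    cancel low lift_center.
Proof.
have /choice[low lowK] := lift_center_surj.
have lowD : nmod_morphism low.
  split=> [|c d]; apply: lift_center_inj; first by rewrite rmorph0 lowK.
  rewrite [RHS](rmorphD lift_center).
  exact: etrans (lowK _) (esym (congr2 +%R (lowK c) (lowK d))).
have lowM : monoid_morphism low.
  split=> [|c d]; apply: lift_center_inj; first by rewrite rmorph1 lowK.
  rewrite [RHS](rmorphM lift_center).
  exact: etrans (lowK _) (esym (congr2 *%R (lowK c) (lowK d))).
pose low' : {rmorphism center {poly A} -> {poly center A}} := HB.pack low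
  (GRing.isNmodMorphism.Build _ _ low lowD)
  (GRing.isMonoidMorphism.Build _ _ low lowM).
by exists low'.
Qed.

End PolyCenter.

Section Evaluation.

Variables (A : nzRingType) (r : center A).

Fact eval_at_comm : commr_rmorph (idfun : A -> A) (val r).
Proof. by move=> a; apply: (centralP _ (valP r)). Qed.

Definition eval_at : {rmorphism {poly A} -> A} := horner_morph eval_at_comm.

Lemma eval_atE p : eval_at p = p.[val r].
Proof. by rewrite /eval_at /= /horner_morph map_poly_id. Qed.

Lemma eval_at_polyC : cancel polyC eval_at.
Proof. by move=> a; rewrite eval_atE hornerC. Qed.

End Evaluation.

Lemma annihilated_kernel (A : nzRingType) (r : center A)
    (M : lmodType {poly A}^c) :
  (forall x, central_act (lift_center ('X - r%:P)) M x = 0) ->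
  forall (p : {poly A}) (x : M), eval_at r p = 0 -> (p : {poly A}^c) *: x = 0.
Proof.
move=> killed p x; rewrite eval_atE => /eqP/factor_theorem[q ->].
rewrite -lift_center_XsubC -[RHS](killed ((q : {poly A}^c) *: x)) /=.
by rewrite scalerA.
Qed.

(** The kernel of evaluation at r is generated by 'X - r, and the constant
    polynomials are a section of that evaluation. *)
Lemma annihilator_restriction (A : nzRingType) (r : center A)
    (M : lmodType {poly A}^c) :
  (forall x, central_act (lift_center ('X - r%:P)) M x = 0) <->
  exists N : lmodType A^c,
    @isomorphic (right_modules {poly A}) M (fobj (restriction (eval_at r)) N).
Proof.
split=> [killed|[N [h [h' [h'h _]]]] x].
  apply: (restriction_image (iota := polyC)); first exact: eval_at_polyC.
  exact: annihilated_kernel.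
pose g : {linear M -> restricted (eval_at r) N} := h.
pose g' : {linear restricted (eval_at r) N -> M} := h'.
have gK y : g' (g y) = y.
  exact: (congr1 (fun u : {linear M -> M} => u y) h'h).
rewrite -[LHS]gK central_act_natural /= restricted_scaleE.
have -> : eval_at r (val (lift_center ('X - r%:P))) = 0.
  by rewrite eval_atE lift_center_XsubC hornerXsubC subrr.
by rewrite scale0r linear0.
Qed.

(** * Cancellation *)

Theorem poly_morita_cancel (A B : nzRingType) :
  pi_regular (center A) ->
  equivalent (right_modules {poly A}) (right_modules {poly B}) ->
  equivalent (right_modules A) (right_modules B).
Proof.
move=> regA /equivalence_center[F [[F_full F_faithful F_surj]]].
move=> [phi [phi_surj phi_corr]].
have [low lowK] := lift_center_inverse B.
pose psi : {rmorphism {poly center A} -> {poly center B}} :=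
  low \o (phi \o @lift_center A).
have psi_surj p : exists q, psi q = p.
  have [c phi_c] := phi_surj (lift_center p).
  have [q q_c] := lift_center_surj c; exists q.
  by apply: lift_center_inj; rewrite /psi /= q_c phi_c lowK.
have [r [w [w' [psiX ww']]]] :=
  residually_linear_factor (surjective_residually_linear regA psi_surj).
(* psi 'X and 'X - r generate the same ideal, so they kill the same modules. *)
have killed (M : lmodType {poly A}^c) :
    (forall x, central_act (lift_center ('X - 0%:P)) M x = 0) <->
    (forall y, central_act (lift_center ('X - r%:P))
       (fobj F M : lmodType {poly B}^c) y = 0).
  have phiX : phi (lift_center ('X - 0%:P)) =
      lift_center w * lift_center ('X - r%:P).
    by rewrite subr0 -[LHS]lowK -rmorphM -psiX.
  have kill := corresponding_kill M F_full F_faithful (phi_corr _).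
  split=> [/kill k0 y|k0]; last first.
    by apply/kill => y; rewrite phiX central_actM k0 linear0.
  have -> : lift_center ('X - r%:P) =
      lift_center w' * phi (lift_center ('X - 0%:P)).
    by rewrite phiX mulrA -rmorphM mulrC [w' * w]mulrC ww' rmorph1 mulr1.
  by rewrite central_actM k0 linear0.
pose P := functor_comp F (restriction (eval_at (0 : center A))).
pose Q := restriction (eval_at r).
have surj (C : nzRingType) (s : center C) a : exists p, eval_at s p = a.
  by exists a%:P; apply: eval_at_polyC.
apply: (@common_image_equivalent _ _ _ P Q).
- by apply: full_comp => //; apply: restriction_full; apply: surj.
- by apply: faithful_comp => //; apply: restriction_faithful.
- by apply: restriction_full; apply: surj.
- exact: restriction_faithful.
- move=> M; apply/annihilator_restriction/killed/annihilator_restriction.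
  by exists M; apply: isomorphic_refl.
- move=> N.
  have [M FM_N] := F_surj (fobj Q N).
  have /killed/annihilator_restriction[M' M_M'] :
      forall y, central_act (lift_center ('X - r%:P))
        (fobj F M : lmodType {poly B}^c) y = 0.
    by apply/annihilator_restriction; exists N.
  exists M'; apply: isomorphic_trans (isomorphic_sym FM_N) _.
  exact: (isomorphic_fobj F M_M').
Qed.

Theorem theorem0p3 (k : fieldType) (A : algType k)
    (A_strongly_hopfian : strongly_hopfian A)
    (center_artinian : artinian (center A)) :
  morita_cancellative A.
Proof.
move=> B; exact/poly_morita_cancel/artinian_pi_regular.
Qed.
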